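(* Let $m\in\{1,2,\ldots\}$ and let $\check\rho,\hat\rho>0$ with $\hat\rho=n\check\rho$ for some integer $n\ge 2$. Let $(\check D_0,\check D_1)\in\mathrm{bd}_{\check\rho}$ and $(\hat D_0,\hat D_1)=\partial R(\check D_0,\check D_1)$. Let $\hat H_0,\hat H_1\subset\Delta_{\hat\rho}$ be the sets generated by the following procedure: start with $\hat H_0=\hat H_1=\emptyset$; for each $\hat x\in B_{3\hat\rho/2}(\check D_0)\cap\Delta_{\hat\rho}$, if $\mathrm{d}(\hat x,\check D_0)\le\hat\rho/2$, add $\hat x$ to $\hat H_0$; otherwise, if $\mathrm{d}(\hat x,\check D_1)\le\mathrm{d}(\hat x,\check D_0)$, add $\hat x$ to $\hat H_1$. Then \[\hat D_0=\{\hat x\in\hat H_0:\mathrm{d}(\hat x,\hat H_1)=\hat\rho\},\qquad \hat D_1=\{\hat x\in\hat H_1:\mathrm{d}(\hat x,\hat H_0)=\hat\rho\}.\]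
   Context: $\mathbb{R}^m$ carries the maximum norm $\|x\|_\infty=\max_{1\le j\le m}|x_j|$. For a point $x\in\mathbb{R}^m$ and nonempty $A\subset\mathbb{R}^m$, $\mathrm{d}(x,A)=\inf_{y\in A}\|x-y\|_\infty$, and $\mathrm{d}(x,\emptyset)=\infty$. For $A\subset\mathbb{R}^m$ and $\delta>0$, $B_\delta(A)=\{x\in\mathbb{R}^m:\mathrm{d}(x,A)\le\delta\}$ (so $B_\delta(\emptyset)=\emptyset$). $M^c$ is the complement in $\mathbb{R}^m$. For $\rho>0$: $\Delta_\rho=\rho\mathbb{Z}^m$, $S_\rho=\{M\subset\Delta_\rho:M\neq\emptyset\}$, $S_\rho^+=2^{\Delta_\rho}$. For $M\in S_\rho^+$: $\partial^0_\rho M=\{x\in M:\exists z\in M^c\cap\Delta_\rho,\ \|x-z\|_\infty=\rho\}$ and $\partial^1_\rho M=\{z\in M^c\cap\Delta_\rho:\mathrm{d}(z,\partial^0_\rho M)=\rho\}$. Paths: for $x,z\in\Delta_\rho$, $P_\rho(x,z)$ is the set of finite sequences $p=(\xi_0,\ldots,\xi_k)$ in $\Delta_\rho$, $k\in\{0,1,2,\ldots\}$, with $\xi_0=x$, $\xi_k=z$ and $\|\xi_\ell-\xi_{\ell-1}\|_\infty\le\rho$ for $\ell=1,\ldots,k$; $L(p)=k$, $p(\ell)=\xi_\ell$. $\mathrm{bd}_\rho^-\subset S_\rho^+\times S_\rho^+$ is the set of all pairs $(D_0,D_1)$ such that (1) $D_0\neq\emptyset\neq D_1$; (2) $D_0\cap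 D_1=\emptyset$; (3) for every $x\in D_0$ there is $z\in D_1$ with $\|x-z\|_\infty=\rho$; (4) for every $z\in D_1$ there is $x\in D_0$ with $\|x-z\|_\infty=\rho$; (5) for all $x\in D_0$, $z\in D_1$ and $p\in P_\rho(x,z)$ with $L(p)>1$ there is an integer $0<\ell<L(p)$ with $p(\ell)\in D_0\cup D_1$. Moreover $\mathrm{bd}_\rho=\mathrm{bd}_\rho^-\cup\{(\emptyset,\emptyset)\}$. $\mathrm{Tr}_\rho(M)=(\partial^0_\rho M,\partial^1_\rho M)$ for $M\in S_\rho$. It is a bijection $\mathrm{Tr}_\rho:S_\rho\to\mathrm{bd}_\rho$, whose inverse is given by $\mathrm{Tr}_\rho^{-1}(\emptyset,\emptyset)=\Delta_\rho$ and $\mathrm{Tr}_\rho^{-1}(D_0,D_1)=\{x\in\Delta_\rho:\mathrm{d}(x,D_0)<\mathrm{d}(x,D_1)\}$ for $(D_0,D_1)\in\mathrm{bd}_\rho^-$. Restriction operator: $R:S_{\check\rho}\to S_{\hat\rho}$, $R(M)=B_{\hat\rho/2}(M)\cap\Delta_{\hat\rho}$. Lifted restriction operator: $\partial R:\mathrm{bd}_{\check\rho}\to\mathrm{bd}_{\hat\rho}$, $\partial R=\mathrm{Tr}_{\hat\rho}\circ R\circ\mathrm{Tr}_{\check\rho}^{-1}$. *)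

(* Defs.v *)
From HB Require Import structures.
From mathcomp Require Import all_boot all_order all_algebra.
From mathcomp Require Import all_classical all_reals all_analysis.

Set Implicit Arguments.
Unset Strict Implicit.
Unset Printing Implicit Defensive.

Import Order.TTheory GRing.Theory Num.Theory.
Import numFieldNormedType.Exports.

Local Open Scope classical_set_scope.
Local Open Scope ring_scope.

(* MathComp-Analysis world. On 'rV[R]_m the library norm `|x| is the maximum
   norm (mx_norm, see mx_normrE). *)

Section Defs.
Context {R : realType} {m : nat}.
Local Notation V := 'rV[R]_m.
Implicit Types (x z : V) (A M : set V) (rho : R).

(* [ereal_inf set0 = +oo], so the distance to the empty set is +oo. *)
Definition dist x A : \bar R := ereal_inf [set (`|x - y|)%:E | y in A].

Definition closed_nbhd (delta : R) A : set V :=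
  [set x | (dist x A <= delta%:E)%E].

Definition grid rho : set V :=
  [set x | forall j : 'I_m, exists k : int, x ord0 j = rho * k%:~R].

Definition Splus rho : set (set V) := [set M | M `<=` grid rho].

Definition Sne rho : set (set V) := [set M | M `<=` grid rho /\ M !=set0].

Definition bdry0 rho M : set V :=
  [set x | M x /\ exists z, (~` M `&` grid rho) z /\ `|x - z| = rho].

Definition bdry1 rho M : set V :=
  [set z | (~` M `&` grid rho) z /\ dist z (bdry0 rho M) = rho%:E].

(* A path (xi_0, ..., xi_k) is the sequence [:: xi_0; ...; xi_k], of size
   k + 1. *)
Definition path_length (p : seq V) : nat := (size p).-1.

Definition path_pt (p : seq V) (l : nat) : V := nth 0 p l.

Definition paths rho x z : set (seq V) :=
  [set p | [/\ (0 < size p)%N,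
    forall l, (l <= path_length p)%N -> grid rho (path_pt p l),
    path_pt p 0 = x,
    path_pt p (path_length p) = z &
    forall l, (1 <= l <= path_length p)%N ->
      `|path_pt p l - path_pt p l.-1| <= rho]].

Definition bd_minus rho : set (set V * set V) :=
  [set D | [/\ Splus rho D.1 /\ Splus rho D.2,
    D.1 !=set0 /\ D.2 !=set0,
    D.1 `&` D.2 = set0,
    (forall x, D.1 x -> exists z, D.2 z /\ `|x - z| = rho) /\
    (forall z, D.2 z -> exists x, D.1 x /\ `|x - z| = rho) &
    forall x z p, D.1 x -> D.2 z -> paths rho x z p ->
      (1 < path_length p)%N ->
      exists l, (0 < l < path_length p)%N /\ (D.1 `|` D.2) (path_pt p l)]].

Definition bd rho : set (set V * set V) := bd_minus rho `|` [set (set0, set0)].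

Definition Tr rho M : set V * set V := (bdry0 rho M, bdry1 rho M).

(* [pinv A f] is the library's inverse of the restriction of f to A. As [Tr rho]
   is a bijection from [Sne rho] onto [bd rho], this is its inverse on [bd rho];
   the values outside [bd rho] are irrelevant. *)
Definition Tr_inv rho : set V * set V -> set V := pinv (Sne rho) (Tr rho).

Definition restr (rhoh : R) M : set V := closed_nbhd (rhoh / 2) M `&` grid rhoh.

Definition lifted_restr (rhoc rhoh : R) (D : set V * set V) : set V * set V :=
  Tr rhoh (restr rhoh (Tr_inv rhoc D)).

(* The outcome of a loop over the points of [closed_nbhd (3 * rhoh / 2) D0] in
   [grid rhoh], in which each point is treated independently of the others:
   [proc_H0] collects those passing the first test, [proc_H1] those failing it
   and passing the second one. *)
Definition proc_H0 (rhoh : R) (D0 : set V) : set V :=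
  [set x | (closed_nbhd (3 * rhoh / 2) D0 `&` grid rhoh) x /\
           (dist x D0 <= (rhoh / 2)%:E)%E].

Definition proc_H1 (rhoh : R) (D0 D1 : set V) : set V :=
  [set x | [/\ (closed_nbhd (3 * rhoh / 2) D0 `&` grid rhoh) x,
           ~ (dist x D0 <= (rhoh / 2)%:E)%E &
           (dist x D1 <= dist x D0)%E]].

End Defs.

(* Main.v *)
Require Import Defs.
From HB Require Import structures.
From mathcomp Require Import all_boot all_order all_algebra.
From mathcomp Require Import all_classical all_reals all_analysis.
From mathcomp Require Import lra zify.

Set Implicit Arguments.
Unset Strict Implicit.
Unset Printing Implicit Defensive.

Import Order.TTheory GRing.Theory Num.Theory.
Import numFieldNormedType.Exports.

Local Open Scope classical_set_scope.
Local Open Scope ring_scope.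

(** Write [M] for the set encoded by [(Dc0, Dc1)], so that [Dc0] and [Dc1] are
    its inner and outer boundaries, and [N] for the restriction of [M] to the
    coarse grid; [Dh0] and [Dh1] are the boundaries of [N].

    The loop produces [Hh0] inside [N] and [Hh1] outside [N], and although these
    are only parts of [N] and of its complement, they contain every pair of
    coarse neighbours [x], [z] with [x] in [N] and [z] outside [N]
    ([restr_edge]). The boundaries of [N] are made of exactly such pairs, so
    they can be read off from [Hh0] and [Hh1]; as these are disjoint subsets of
    the grid, being at distance [rhoh] from the other set means having a
    neighbour in it ([dist_eq_meshP]).

    The geometric input is [geodesic_crossing]: a shortest grid path from a
    point of [M] to a point outside [M] uses an edge from the inner to the outer
    boundary, and distances add up along it. It shows that, unless [M] is the
    full grid, a fine grid point is in [M] if and only if it is closer to the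
    inner than to the outer boundary, so that the second test of the loop
    decides membership in the complement of [M], and that any nearest point
    of [M] to an outside point lies on the inner boundary. Applied to a shortest
    path between coarse neighbours [x] in [M] and [z] outside [N], it finds
    an inner boundary point at distance at most [rhoh / 2] of [x], because
    every point of [M] is further than [rhoh / 2] from [z] and the path has
    total length [rhoh].

    That [M] exists at all is the surjectivity of [Tr], proved in
    [Tr_bd_inside]: the separation axiom of [bd_minus] makes the points that can
    be reached from the inner set without meeting the outer one a set with the
    prescribed boundaries. *)

(** * Distances in a grid *)

Section Grid.
Context {R : realType} {m : nat}.
Implicit Types (x y z w : 'rV[R]_m) (A B M : set 'rV[R]_m) (rho r : R).

Lemma rV_norm_leP x r : 0 <= r ->
  `|x| <= r <-> (forall j : 'I_m, `|x ord0 j| <= r).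
Proof.
move=> r0; rewrite [`|x|]mx_normrE; split=> [xr j|xr].
  exact: le_trans (le_bigmax _ (fun ij : 'I_1 * 'I_m => `|x ij.1 ij.2|)
    (ord0, j)) xr.
by apply: bigmax_le => // -[i j] _ /=; rewrite (ord1 i).
Qed.

Lemma gridB rho x y : grid rho x -> grid rho y -> grid rho (x - y).
Proof.
move=> gx gy j; have [a ax] := gx j; have [b bx] := gy j; exists (a - b).
by rewrite !mxE ax bx intrB mulrBr.
Qed.

Lemma grid_natmul rho (n : nat) : grid (n%:R * rho) `<=` @grid R m rho.
Proof.
move=> x gx j; have [k ->] := gx j; exists (n%:Z * k).
by rewrite intrM -mulrA mulrC mulrA mulrAC.
Qed.

Lemma grid_norm rho x : 0 < rho -> grid rho x ->
  exists k : nat, `|x| = rho * k%:R.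
Proof.
move=> rho0 gx; have [->|x0] := eqVneq x 0.
  by exists 0%N; rewrite normr0 mulr0.
have /mx_norm_neq0 [[i j] /= xE] : mx_norm x != 0.
  by apply: contra x0 => /eqP/mx_norm_eq0 ->.
have [k xk] := gx j; exists `|k|%N.
rewrite [`|x|]xE (ord1 i) xk normrM (gtr0_norm rho0).
by rewrite -intr_norm -abszE natr_absz.
Qed.

Lemma grid_dist_ge rho x y : 0 < rho -> grid rho x -> grid rho y ->
  x <> y -> rho <= `|x - y|.
Proof.
move=> rho0 gx gy xy; have [k kE] := grid_norm rho0 (gridB gx gy).
have : `|x - y| != 0 by rewrite normr_eq0 subr_eq0; apply/eqP.
rewrite kE; case: k {kE} => [|k]; first by rewrite mulr0 eqxx.
by move=> _; rewrite ler_peMr ?ler1n // ltW.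
Qed.

Lemma dist_le x A a r : A a -> `|x - a| <= r -> (dist x A <= r%:E)%E.
Proof.
move=> Aa xa; apply: le_trans (_ : ((`|x - a|)%:E <= _)%E); last by rewrite lee_fin.
by apply: ereal_inf_lbound; exists a.
Qed.

Lemma le_dist x A (e : \bar R) :
  (forall a, A a -> (e <= (`|x - a|)%:E)%E) -> (e <= dist x A)%E.
Proof. by move=> eA; apply: le_ereal_inf_tmp => _ [a Aa <-]; exact: eA. Qed.

(** Distances between grid points are natural multiples of the mesh size, so the
    infimum is attained even when [A] is infinite. *)
Lemma grid_nearest rho x A : 0 < rho -> grid rho x -> A `<=` grid rho ->
  A !=set0 -> exists2 a, A a & dist x A = (`|x - a|)%:E.
Proof.
move=> rho0 gx gA [a0 Aa0].
pose P k := `[< exists2 a, A a & `|x - a| = rho * k%:R >].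
have exP : exists k, P k.
  have [k kE] := grid_norm rho0 (gridB gx (gA _ Aa0)).
  by exists k; apply/asboolP; exists a0.
case: (ex_minnP exP) => k /asboolP [a Aa aE] kmin; exists a => //.
apply/eqP; rewrite eq_le (dist_le Aa) //=; apply: le_dist => b Ab.
have [l lE] := grid_norm rho0 (gridB gx (gA _ Ab)).
rewrite lee_fin aE lE ler_pM2l // ler_nat; apply: kmin.
by apply/asboolP; exists b.
Qed.

Lemma dist_leP rho x A r : 0 < rho -> grid rho x -> A `<=` grid rho ->
  (dist x A <= r%:E)%E <-> (exists2 a, A a & `|x - a| <= r).
Proof.
move=> rho0 gx gA; split=> [|[a Aa xa]]; last exact: dist_le Aa xa.
have [->|/set0P A0] := eqVneq A set0.
  by rewrite /dist image_set0 ereal_inf0 leye_eq.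
have [a Aa ->] := grid_nearest rho0 gx gA A0.
by rewrite lee_fin => xa; exists a.
Qed.

Lemma dist_le_distP rho x A B : 0 < rho -> grid rho x -> A `<=` grid rho ->
  (dist x A <= dist x B)%E <->
  (forall b, B b -> exists2 a, A a & `|x - a| <= `|x - b|).
Proof.
move=> rho0 gx gA; split=> [AB b Bb|AB].
  by apply/(dist_leP _ rho0 gx gA)/(le_trans AB)/(dist_le Bb).
apply: le_dist => b Bb; apply/(dist_leP _ rho0 gx gA); exact: AB.
Qed.

Lemma dist_eq_meshP rho x A : 0 < rho -> grid rho x -> A `<=` grid rho ->
  ~ A x -> dist x A = rho%:E <-> (exists2 a, A a & `|x - a| = rho).
Proof.
move=> rho0 gx gA nAx.
have far a : A a -> rho <= `|x - a|.
  by move=> Aa; apply: (grid_dist_ge rho0 gx (gA _ Aa)) => xa; apply: nAx; rewrite xa.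
split=> [xA|[a Aa xa]].
  have /(dist_leP _ rho0 gx gA) [a Aa xa] : (dist x A <= rho%:E)%E by rewrite xA.
  by exists a => //; apply/eqP; rewrite eq_le xa far.
apply/eqP; rewrite eq_le (dist_le Aa) ?xa //=.
by apply: le_dist => b Bb; rewrite lee_fin far.
Qed.

(** In the maximum norm every coordinate can approach its target at the same
    time, so one grid step shortens the distance by a full mesh size. *)
Lemma grid_step rho x z (k : nat) : 0 < rho -> grid rho x -> grid rho z ->
  `|x - z| <= rho * k.+1%:R ->
  exists x', [/\ grid rho x', `|x - x'| <= rho & `|x' - z| <= rho * k%:R].
Proof.
move=> rho0 gx gz.
have rk (i : nat) : 0 <= rho * i%:R by rewrite mulr_ge0 ?ler0n ?ltW.
move=> /(rV_norm_leP _ (rk _)) xz.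
have dj j : exists d : int, (x - z) ord0 j = rho * d%:~R /\ (`|d| <= k.+1)%N.
  have [d dE] := gridB gx gz j; exists d; split=> //.
  have := xz j; rewrite dE normrM gtr0_norm // ler_pM2l //.
  by rewrite -intr_norm -[k.+1%:R]/(k.+1%:~R) ler_int; lia.
(* The step moves each coordinate that is off target by one mesh size towards
   [z] and leaves the others in place. *)
pose s := \row_j (rho * Num.sg ((x - z) ord0 j)).
have sE j : exists d : int, [/\ (x - z) ord0 j = rho * d%:~R, (`|d| <= k.+1)%N
    & s ord0 j = rho * (sgz d)%:~R].
  have [d [dE dk]] := dj j; exists d; split=> //.
  by rewrite mxE dE sgrM gtr0_sg // mul1r -intr_sg sgrz.
exists (x - s); split.
- apply: gridB => // j; have [d [_ _ ->]] := sE j; by exists (sgz d).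
- rewrite opprB addrCA subrr addr0; apply/rV_norm_leP; first exact: ltW.
  move=> j; have [d [_ _ ->]] := sE j.
  rewrite normrM gtr0_norm // ler_piMr ?(ltW rho0) // -intr_norm lerz1.
  by rewrite normr_sgz; case: eqP.
- apply/rV_norm_leP => // j; have [d [dE dk sd]] := sE j.
  rewrite addrAC mxE dE mxE sd -mulrBr normrM gtr0_norm // ler_pM2l //.
  rewrite -intrB -intr_norm -[k%:R]/(k%:~R) ler_int.
  by case: d dk {dE sd} => [[|d]|d] dk; rewrite ?sgz0; lia.
Qed.

(** * Boundaries and geodesics *)

Lemma bdry0_sub rho M : bdry0 rho M `<=` M.
Proof. by move=> x []. Qed.

Lemma bdry1P rho M z : 0 < rho -> M `<=` grid rho ->
  bdry1 rho M z <->
  [/\ grid rho z, ~ M z & exists2 x, bdry0 rho M x & `|z - x| = rho].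
Proof.
move=> rho0 gM; have g0 := subset_trans (@bdry0_sub rho M) gM.
split=> [[[nMz gz] dz]|[gz nMz ex]].
  split=> //; apply/(dist_eq_meshP rho0 gz g0) => //.
  by move/bdry0_sub.
split=> //; apply/(dist_eq_meshP rho0 gz g0) => //.
by move/bdry0_sub.
Qed.

Lemma bdry_edge rho M x z : 0 < rho -> M `<=` grid rho ->
  M x -> grid rho z -> ~ M z -> `|x - z| <= rho ->
  [/\ bdry0 rho M x, bdry1 rho M z & `|x - z| = rho].
Proof.
move=> rho0 gM Mx gz nMz xz.
have xzE : `|x - z| = rho.
  apply/eqP; rewrite eq_le xz; apply: grid_dist_ge rho0 (gM _ Mx) gz _.
  by move=> xz'; apply: nMz; rewrite -xz'.
have b0 : bdry0 rho M x by split=> //; exists z.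
by split=> //; apply/bdry1P => //; split=> //; exists x; rewrite // distrC.
Qed.

(** Along a shortest path from [x] to [z], the last point [y] before the first
    exit from [M] and the exit point [w] lie on the two boundaries. The estimate
    says that the three pieces of the path fit into its total length. *)
Lemma geodesic_crossing rho M x z : 0 < rho -> M `<=` grid rho ->
  M x -> grid rho z -> ~ M z ->
  exists y w, [/\ bdry0 rho M y, bdry1 rho M w, `|y - w| = rho &
    `|x - y| + rho + `|w - z| <= `|x - z|].
Proof.
move=> rho0 gM Mx gz nMz.
have [k kE] := grid_norm rho0 (gridB (gM _ Mx) gz).
have xz : `|x - z| <= rho * k%:R by rewrite kE.
rewrite kE; elim: k x Mx {kE} xz => [|k IH] x Mx.
  rewrite mulr0 normr_le0 subr_eq0 => /eqP xz.
  by case: nMz; rewrite -xz.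
move=> /(grid_step rho0 (gM _ Mx) gz) [x' [gx' xx' x'z]].
have kS : rho * k.+1%:R = rho * k%:R + rho by rewrite -natr1 mulrDr mulr1.
have [Mx'|nMx'] := pselect (M x').
  have [y [w [b0 b1 yw le]]] := IH _ Mx' x'z; exists y, w; split=> //.
  have := ler_distD x' x y; lra.
have [b0 b1 e] := bdry_edge rho0 gM Mx gx' nMx' xx'; exists x, x'; split=> //.
rewrite subrr normr0; lra.
Qed.

(** * Surjectivity of the trace *)

(** The points reached from [D.1] by grid paths that avoid [D.1] and [D.2] after
    their start. Forbidding returns to [D.1] makes any such path that ends by
    stepping into [D.2] a forbidden one for the separation axiom, unless it
    consists of that single step. *)
Definition bd_inside rho (D : set 'rV[R]_m * set 'rV[R]_m) : set 'rV[R]_m :=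
  [set x | exists x0 p, [/\ D.1 x0,
    path (fun y z => `[< `|y - z| <= rho >]) x0 p,
    (forall y, y \in p -> grid rho y /\ ~ (D.1 `|` D.2) y) & x = last x0 p]].

(** A grid step leaving this set must enter [D.2], since otherwise the path could
    be extended; the separation axiom then forces it to start in [D.1]. *)
Lemma Tr_bd_inside rho D : 0 < rho -> bd_minus rho D ->
  Sne rho (bd_inside rho D) /\ Tr rho (bd_inside rho D) = D.
Proof.
case: D => D0 D1 rho0 [/= [g0 g1] [[d0 D0d0] _] D01 [nb0 nb1] sep].
set M := bd_inside _ _.
have D0M : D0 `<=` M by move=> x D0x; exists x, [::]; split.
have MD1 x : M x -> ~ D1 x.
  move=> [x0 [p [D0x0 _ pD ->]]]; case: (lastP p) pD => [_ D1x|s y pD D1x].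
    by have : (D0 `&` D1) x0 by []; rewrite D01.
  rewrite last_rcons in D1x.
  by have [|_] := pD y; [rewrite mem_rcons mem_head|apply; right].
have gM : M `<=` grid rho.
  move=> x [x0 [p [/g0 gx0 _ pD ->]]].
  have := mem_last x0 p; rewrite inE => /orP[/eqP -> //|/pD []//].
have edge x z : M x -> grid rho z -> ~ M z -> `|x - z| <= rho -> D0 x /\ D1 z.
  move=> [x0 [p [D0x0 ep pD xE]]] gz nMz xz.
  have eq_z : path (fun y z => `[< `|y - z| <= rho >]) x0 (rcons p z).
    by rewrite rcons_path ep /= -xE; apply/asboolP.
  have [[D0z|D1z]|nDz] := pselect ((D0 `|` D1) z).
  - by case: nMz; apply: D0M.
  - split=> //; case: (posnP (size p)) => [/size0nil p0|p_gt0].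
      by rewrite xE p0.
    pose q := x0 :: rcons p z.
    have szq : path_length q = (size p).+1 by rewrite /path_length /= size_rcons.
    have gq y : y \in q -> grid rho y.
      rewrite inE mem_rcons inE => /or3P[/eqP ->|/eqP ->|/pD []//]; first exact: g0.
      exact: gz.
    have qp : paths rho x0 z q.
      split=> //.
      - by move=> l lq; apply: gq; rewrite mem_nth // (leq_ltn_trans lq).
      - by rewrite szq /path_pt /= nth_rcons ltnn eqxx.
      - case=> [//|l] /andP[_]; rewrite szq => lp.
        have := pathP 0 eq_z l; rewrite size_rcons => /(_ lp)/asboolP.
        by rewrite distrC.
    have [|[|l] []] := sep _ _ _ D0x0 D1z qp; rewrite szq // => /andP[_].
    rewrite ltnS => lp.
    rewrite /path_pt /= nth_rcons lp.
    by have [|_] := pD (nth 0 p l); rewrite ?mem_nth.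
  - case: nMz; exists x0, (rcons p z); split=> //; last by rewrite last_rcons.
    by move=> y; rewrite mem_rcons inE => /orP[/eqP ->|/pD].
have b0 : bdry0 rho M = D0.
  apply/seteqP; split=> [x [Mx [z [[nMz gz] xz]]]|x D0x].
    by have [] := edge _ _ Mx gz nMz; rewrite ?xz.
  have [z [D1z xz]] := nb0 _ D0x; split; first exact: D0M.
  by exists z; split=> //; split; [move/MD1|exact: g1].
split; first by split=> //; exists d0; exact: D0M.
rewrite /Tr b0; congr pair; apply/seteqP; split=> [z|z D1z].
  move=> /(bdry1P _ rho0 gM) [gz nMz [x /bdry0_sub Mx zx]].
  by have [] := edge _ _ Mx gz nMz; rewrite // distrC zx.
apply/(bdry1P _ rho0 gM); split; [exact: g1|by move/MD1|].
by have [x [D0x xz]] := nb1 _ D1z; exists x; rewrite ?b0 // distrC.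
Qed.

Lemma Tr_grid rho : 0 < rho ->
  Sne rho (@grid R m rho) /\ Tr rho (@grid R m rho) = (set0, set0).
Proof.
move=> rho0; split; first by split=> //; exists 0 => j; exists 0; rewrite mxE mulr0.
congr pair; apply/seteqP; split=> // x; first by case=> _ [z [[]]].
by case=> -[].
Qed.

Lemma Tr_invK rho (D : set 'rV[R]_m * set 'rV[R]_m) : 0 < rho -> bd rho D ->
  Sne rho (Tr_inv rho D) /\ Tr rho (Tr_inv rho D) = D.
Proof.
move=> rho0 bdD.
have ex : (Tr rho @` Sne rho) D.
  case: bdD => [/(Tr_bd_inside rho0) [SM TM]|/= ->]; first by exists (bd_inside rho D).
  by have [SM TM] := Tr_grid rho0; exists (grid rho).
split; last by apply: pinvK; rewrite inE.
have := @surjpinv_image_sub _ _ (fun=> point) (Sne rho) _ (Tr rho) (@subset_refl _ _).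
by apply; exists D.
Qed.

End Grid.

(** * The restriction to a coarser grid *)

Section Restriction.
Context {R : realType} {m : nat} (rhoc rhoh : R) (M : set 'rV[R]_m).
Context (rhoc0 : 0 < rhoc) (rhoh0 : 0 < rhoh).
Context (gM : M `<=` grid rhoc) (ghc : grid rhoh `<=` @grid R m rhoc).
Local Notation D0 := (bdry0 rhoc M).
Local Notation D1 := (bdry1 rhoc M).
Local Notation H0 := (proc_H0 rhoh D0).
Local Notation H1 := (proc_H1 rhoh D0 D1).
Local Notation N := (restr rhoh M).

Lemma bdry0_grid : D0 `<=` grid rhoc.
Proof. exact: subset_trans (@bdry0_sub _ _ _ _) gM. Qed.
Let gD0 := bdry0_grid.

Lemma bdry1_grid : D1 `<=` grid rhoc.
Proof. by move=> z [[]]. Qed.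
Let gD1 := bdry1_grid.

(** A point of [M] that is nearest to an outside point is an inner boundary
    point, as a shortest path to it enters [M] there. *)
Lemma bdry0_near x y r : grid rhoc x -> ~ M x -> M y -> `|x - y| <= r ->
  (dist x D0 <= r%:E)%E.
Proof.
move=> gx nMx My xy.
have [y' [w [D0y' _ yw]]] := geodesic_crossing rhoc0 gM My gx nMx => le.
apply: (dist_le D0y'); rewrite distrC.
by have := ler_distD w y' x; have := normr_ge0 (y - y'); rewrite (distrC x) in xy; lra.
Qed.

(** A shortest path from [x] to its nearest outer boundary point meets the inner
    boundary earlier. Without a point [b], as for the full grid, both distances
    would be infinite. *)
Lemma inside_closer x b : M x -> D0 b -> ~ (dist x D1 <= dist x D0)%E.
Proof.
move=> Mx D0b D10; have gx := gM Mx.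
have [b' D0b' b'E] := grid_nearest rhoc0 gx gD0 (ex_intro _ _ D0b).
have [a D1a xa] := (dist_le_distP _ rhoc0 gx gD1).1 D10 b' D0b'.
have [[nMa _] _] := D1a.
have [y [w [D0y _ _ xyw]]] := geodesic_crossing rhoc0 gM Mx (gD1 D1a) nMa.
have := dist_le D0y (lexx `|x - y|); rewrite b'E lee_fin => b'y.
have wa := normr_ge0 (w - a); have rho0 := rhoc0; clear D10 b'E; lra.
Qed.

Lemma outside_closer x : grid rhoc x -> ~ M x -> (dist x D1 <= dist x D0)%E.
Proof.
move=> gx nMx; apply/(dist_le_distP _ rhoc0 gx gD1) => b D0b.
have [y [w [_ D1w _ byw]]] := geodesic_crossing rhoc0 gM (bdry0_sub D0b) gx nMx.
exists w => //; rewrite !(distrC x).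
by have := rhoc0; have := normr_ge0 (b - y); lra.
Qed.

Lemma proc_H0_sub : H0 `<=` N.
Proof.
move=> x [[_ gx] /(dist_leP _ rhoc0 (ghc gx) gD0) [a /bdry0_sub Ma xa]].
by split=> //; apply: dist_le Ma xa.
Qed.

(** The loop visits points near [D0] only, so [D0] is nonempty here and the second
    test detects that the point is outside [M]; its distance to [M] is then
    its distance to [D0], which the first test has found too large. *)
Lemma proc_H1_sub : H1 `<=` ~` N.
Proof.
move=> x [[xD0 gx] nxD0 D10] [xM _]; apply: nxD0.
have gcx := ghc gx.
have [b D0b _] := (dist_leP _ rhoc0 gcx gD0).1 xD0.
have [y My xy] := (dist_leP _ rhoc0 gcx gM).1 xM.
by apply: bdry0_near My xy => // Mx; apply: inside_closer Mx D0b D10.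
Qed.

(** If [x] is outside [M], any nearest point of [M] is on the inner boundary. If
    it is in [M], a geodesic to [z] leaves [M] at an inner boundary point [y];
    as [y] is further than [rhoh / 2] from [z], it lies in the half of the
    geodesic that is close to [x]. The test range [3 * rhoh / 2] is
    what the triangle inequality gives for [z]. *)
Lemma restr_edge x z : N x -> grid rhoh z -> ~ N z -> `|x - z| = rhoh ->
  H0 x /\ H1 z.
Proof.
move=> [xM gx] gz nNz xz.
have gcx := ghc gx; have gcz := ghc gz.
have nzM : ~ (dist z M <= (rhoh / 2)%:E)%E by move=> zM; apply: nNz.
have nMz : ~ M z.
  by move=> Mz; apply: nzM; apply: (dist_le Mz); rewrite subrr normr0 divr_ge0 // ltW.
have [a D0a xa] : exists2 a, D0 a & `|x - a| <= rhoh / 2.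
  apply/(dist_leP _ rhoc0 gcx gD0).
  have [Mx|nMx] := pselect (M x); last first.
    have [y My xy] := (dist_leP _ rhoc0 gcx gM).1 xM.
    exact: bdry0_near My xy.
  have [y [w [D0y _ yw]]] := geodesic_crossing rhoc0 gM Mx gcz nMz.
  rewrite xz => xywz; apply: (dist_le D0y); rewrite leNgt; apply/negP => xy.
  apply: nzM; apply: (dist_le (bdry0_sub D0y)); rewrite distrC.
  by have := rhoc0; have := ler_distD w y z; lra.
have nzD0 : ~ (dist z D0 <= (rhoh / 2)%:E)%E.
  move=> /(dist_leP _ rhoc0 gcz gD0) [b /bdry0_sub Mb zb].
  by apply: nzM; apply: dist_le Mb zb.
split; split.
- by split=> //; apply: (dist_le D0a); have := rhoh0; lra.
- exact: dist_le D0a xa.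
- split=> //; apply: (dist_le D0a).
  by have := rhoh0; have := ler_distD x z a; rewrite (distrC z x); lra.
- exact: nzD0.
- exact: outside_closer.
Qed.

Lemma bdry_restr :
  bdry0 rhoh N = [set x | H0 x /\ dist x H1 = rhoh%:E] /\
  bdry1 rhoh N = [set x | H1 x /\ dist x H0 = rhoh%:E].
Proof.
have gN : N `<=` grid rhoh by move=> x [].
have gH0 : H0 `<=` grid rhoh by move=> x /proc_H0_sub /gN.
have gH1 : H1 `<=` grid rhoh by move=> x [[]].
have dis x : H0 x -> ~ H1 x by move=> /proc_H0_sub Nx /proc_H1_sub.
split; apply/seteqP; split=> x.
- move=> [Nx [z [[nNz gz] xz]]]; have [H0x H1z] := restr_edge Nx gz nNz xz.
  split=> //; apply/(dist_eq_meshP rhoh0 (gH0 _ H0x) gH1 (dis _ H0x)).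
  by exists z.
- move=> [H0x /(dist_eq_meshP rhoh0 (gH0 _ H0x) gH1 (dis _ H0x)) [z H1z xz]].
  split; first exact: proc_H0_sub.
  by exists z; split=> //; split; [exact: proc_H1_sub|exact: gH1].
- move=> /(bdry1P _ rhoh0 gN) [gx nNx [y [Ny _] xy]].
  have [H0y H1x] := restr_edge Ny gx nNx (etrans (distrC _ _) xy).
  split=> //; apply/(dist_eq_meshP rhoh0 gx gH0); first by move/dis.
  by exists y.
- move=> [H1x]; have nH0x : ~ H0 x by move/dis.
  move=> /(dist_eq_meshP rhoh0 (gH1 _ H1x) gH0 nH0x) [y H0y xy].
  apply/(bdry1P _ rhoh0 gN); split; [exact: gH1|exact: proc_H1_sub|].
  exists y => //; split; first exact: proc_H0_sub.
  by exists x; rewrite distrC; split=> //; split; [exact: proc_H1_sub|exact: gH1].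
Qed.

End Restriction.

Theorem theorem28 (R : realType) (m : nat) (m_gt0 : (0 < m)%N)
  (rhoc rhoh : R) (rhoc_gt0 : 0 < rhoc) (rhoh_gt0 : 0 < rhoh)
  (n : nat) (n_ge2 : (2 <= n)%N) (rhohE : rhoh = n%:R * rhoc)
  (Dc0 Dc1 Dh0 Dh1 : set 'rV[R]_m)
  (bdDc : bd rhoc (Dc0, Dc1))
  (DhE : (Dh0, Dh1) = lifted_restr rhoc rhoh (Dc0, Dc1)) :
  let Hh0 := proc_H0 rhoh Dc0 in
  let Hh1 := proc_H1 rhoh Dc0 Dc1 in
  Dh0 = [set x | Hh0 x /\ dist x Hh1 = rhoh%:E] /\
  Dh1 = [set x | Hh1 x /\ dist x Hh0 = rhoh%:E].
Proof.
move=> Hh0 Hh1.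
have [[gM _] TrM] := Tr_invK rhoc_gt0 bdDc.
have ghc : grid rhoh `<=` @grid R m rhoc by rewrite rhohE; exact: grid_natmul.
have := bdry_restr rhoc_gt0 rhoh_gt0 gM ghc.
move: DhE TrM => [-> ->] [-> ->]; exact.
Qed.
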